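(* Let $(X,X_+,\mathcal{K},f)$ be an ordered Banach space with a base and let $\{T^n\}$ be a homogeneous discrete Markov chain on $X$ (the powers of a Markov operator $T:X\to X$). The following conditions are equivalent: (i) the chain $\{T^n\}$ is weakly ergodic; (ii) there exist $\rho\in[0,1)$ and $n_0\in\mathbb{N}$ such that $\delta(T^{n_0})\le\rho$; (iii) the chain $\{T^n\}$ is uniformly ergodic; moreover, there are positive constants $C,\alpha$, an $n_0\in\mathbb{N}$ and $y_0\in\mathcal{K}$ such that $$\|T^n-T_{y_0}\|\le C e^{-\alpha n}\qquad\text{for all } n\ge n_0.$$
   Context: Ordered Banach space with a base (OBSB) $(X,X_+,\mathcal{K},f)$: $X\neq\{0\}$ is a real ordered vector space with cone $X_+=\{x\in X: x\ge 0\}$ which is generating ($X=X_+-X_+$); $f$ is a linear functional on $X$ that is strictly positive ($f(x)>0$ whenever $x\in X_+$, $x\ne0$); $\mathcal{K}=\{x\in X_+: f(x)=1\}$ is the base. Let $U$ be the convex hull of $\mathcal{K}\cup(-\mathcal{K})$ and $\|x\|=\inf\{\lambda\ge 0: x\in\lambda U\}$. It is assumed that $U$ is linearly bounded (its intersection with every line is bounded), so that $\|\cdot\|$ is a norm, that $X$ is complete for this norm, and that $X_+$ is closed. All norms on $X$ are this norm, and norms of operators are the corresponding operator norms. A linear operator $T:X\to X$ is positive if $Tx\ge0$ whenever $x\ge 0$; a positive linear operator $T$ is Markov if $T(\mathcal{K})\subset\mathcal{K}$. For $y\in X$, $T_y:X\to X$ is the operator $T_y(x)=f(x)y$. Let $N=\{x\in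 X: f(x)=0\}$. For a bounded linear operator $T:X\to X$, the Dobrushin ergodicity coefficient is $\delta(T)=\sup_{x\in N,\,x\ne0}\frac{\|Tx\|}{\|x\|}$ (with the supremum understood as $0$ if $N=\{0\}$). A nonhomogeneous discrete Markov chain is a family of Markov operators $\{T^{m,n}:X\to X\}$ ($0\le m\le n$ integers) with $T^{m,n}=T^{k,n}T^{m,k}$ for all $m\le k\le n$. It is weakly ergodic if for each integer $k\ge0$, $\lim_{n\to\infty}\sup_{x,y\in\mathcal{K}}\|T^{k,n}x-T^{k,n}y\|=0$. It is uniformly ergodic if there is $y_0\in X$ such that $\lim_{n\to\infty}\|T^{m,n}-T_{y_0}\|=0$ for every $m\ge0$. The homogeneous chain $\{T^n\}$ of a Markov operator $T$ is the chain $T^{k,m}=T^{m-k}$, and weak/uniform ergodicity of $\{T^n\}$ means that of this chain. *)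

(* Defs.v *)
From HB Require Import structures.
From mathcomp Require Import all_boot all_order all_algebra.
From mathcomp Require Import all_classical all_reals all_analysis.

Set Implicit Arguments.
Unset Strict Implicit.
Unset Printing Implicit Defensive.

Import Order.TTheory GRing.Theory Num.Theory.
Import numFieldNormedType.Exports.

Local Open Scope classical_set_scope.
Local Open Scope ring_scope.

Section OrderedSpace.
Context (R : realType) (X : lmodType R) (le : X -> X -> Prop) (f : X -> R).

Definition cone_of : set X := [set x | le 0 x].

Definition base_of : set X := [set x | cone_of x /\ f x = 1].

Definition convex_hull (A : set X) : set X := smallest (@convex_set R X) A.

Definition unit_hull : set X :=
  convex_hull (base_of `|` [set - x | x in base_of]).

Definition gauge_norm (U : set X) (x : X) : R :=
  inf [set l | 0 <= l /\ exists2 u, U u & x = l *: u].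

(* Each line is parametrized by the reals, so that boundedness of the
   intersection with U does not depend on a norm on X. *)
Definition linearly_bounded (U : set X) : Prop :=
  forall x d : X, d != 0 -> bounded_set [set t : R | U (x + t *: d)].

End OrderedSpace.

(* The norm and the topology of X are those of the normed module; [obsb_normE]
   identifies this norm with the gauge of the convex hull of K `|` -K, so that
   completeness of X and closedness of the cone refer to the gauge norm. *)
Record obsb (R : realType) (X : completeNormedModType R) := OBSB {
  obsb_le : X -> X -> Prop ;
  obsb_fun : {scalar X} ;
  obsb_le_refl : forall x, obsb_le x x ;
  obsb_le_anti : forall x y, obsb_le x y -> obsb_le y x -> x = y ;
  obsb_le_trans : forall x y z, obsb_le x y -> obsb_le y z -> obsb_le x z ;
  obsb_leD : forall x y z, obsb_le x y -> obsb_le (x + z) (y + z) ;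
  obsb_leZ : forall (a : R) x y,
    0 <= a -> obsb_le x y -> obsb_le (a *: x) (a *: y) ;
  obsb_neq0 : exists x : X, x != 0 ;
  obsb_generating : forall x, exists y z,
    [/\ cone_of obsb_le y, cone_of obsb_le z & x = y - z] ;
  obsb_fun_gt0 : forall x, cone_of obsb_le x -> x != 0 -> 0 < obsb_fun x ;
  obsb_linearly_bounded : linearly_bounded (unit_hull obsb_le obsb_fun) ;
  obsb_normE : forall x : X, `|x| = gauge_norm (unit_hull obsb_le obsb_fun) x ;
  obsb_cone_closed : closed (cone_of obsb_le) }.

Section Operators.
Context (R : realType) (X : completeNormedModType R) (E : obsb X).

Definition cone : set X := cone_of (obsb_le E).

Definition base : set X := base_of (obsb_le E) (obsb_fun E).

Definition positive_op (T : X -> X) : Prop := forall x, cone x -> cone (T x).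

Definition markov_op (T : X -> X) : Prop :=
  [/\ linear T, positive_op T & T @` base `<=` base].

Definition rank1_op (y : X) : X -> X := fun x => obsb_fun E x *: y.

Definition opnorm (S : X -> X) : \bar R :=
  ereal_sup [set `|S x|%:E | x in [set x | `|x| <= 1]].

Definition null_space : set X := [set x | obsb_fun E x = 0].

(* The maximum with 0 gives the value 0 when null_space is trivial, where the
   extended real supremum of the empty set is -oo. *)
Definition dobrushin (T : X -> X) : \bar R :=
  maxe 0%E (ereal_sup [set (`|T x| / `|x|)%:E
                      | x in [set x | null_space x /\ x != 0]]).

(* The operators T^{m,n} with n < m carry no constraint: they are junk values. *)
Record markov_chain := MarkovChain {
  chain_op : nat -> nat -> X -> X ;
  chain_markov : forall m n, (m <= n)%N -> markov_op (chain_op m n) ;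
  chain_comp : forall m k n, (m <= k)%N -> (k <= n)%N ->
    chain_op m n = chain_op k n \o chain_op m k }.

Definition weakly_ergodic (C : markov_chain) : Prop :=
  forall k, (fun n => ereal_sup
      [set `|chain_op C k n z.1 - chain_op C k n z.2|%:E | z in base `*` base])
    @ \oo --> 0%E.

Definition uniformly_ergodic (C : markov_chain) : Prop :=
  exists y0 : X, forall m,
    (fun n => opnorm (fun x => chain_op C m n x - rank1_op y0 x))
      @ \oo --> 0%E.

Lemma markov_iter (T : X -> X) (n : nat) : markov_op T -> markov_op (iter n T).
Proof.
move=> [linT posT baseT]; elim: n => [|n [lin_n pos_n base_n]].
  by split=> // _ [x bx <-].
split=> [a x y|x cx|_ [x bx <-]] /=.
- by rewrite lin_n linT.
- exact/posT/pos_n.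
- by apply: baseT; exists (iter n T x) => //; apply: base_n; exists x.
Qed.

Lemma iter_comp (T : X -> X) (m k n : nat) : (m <= k)%N -> (k <= n)%N ->
  iter (n - m) T = iter (n - k) T \o iter (k - m) T.
Proof.
by move=> mk kn; apply/funext => x /=; rewrite -iterD addnBA// subnK.
Qed.

Definition homogeneous_chain (T : X -> X) (markovT : markov_op T) : markov_chain :=
  @MarkovChain (fun m n => iter (n - m) T)
    (fun m n _ => markov_iter (n - m) markovT) (@iter_comp T).

End Operators.

(* Main.v *)
Require Import Defs.
From HB Require Import structures.
From mathcomp Require Import all_boot all_order all_algebra.
From mathcomp Require Import all_classical all_reals all_analysis.
From mathcomp Require Import lra.
Import Order.TTheory GRing.Theory Num.Theory.
Import numFieldNormedType.Exports.
Local Open Scope classical_set_scope.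
Local Open Scope ring_scope.

Set Implicit Arguments.
Unset Strict Implicit.
Unset Printing Implicit Defensive.

(** The norm of an ordered Banach space with a base is the cost of a
    decomposition into positive parts: |x| is the infimum of f y + f z over
    x = y - z with y, z in the cone ([normB_cone_le], [cone_decomposition]).
    Everything that is used about the norm comes from this: f is bounded, and a
    Markov operator, which preserves the cone and f, is nonexpansive
    ([markov_nonexpansive]).

    For x in the kernel N of f, both parts have the same mass f y = f z, which
    for a near-optimal decomposition is about |x| / 2, so that T x is about |x| / 2 times a difference T k - T h with k, h
    in the base.  Hence the oscillation of T over the base controls T on N
    ([markov_null_le]).  As weak ergodicity makes this oscillation tend to 0, it
    makes some power of T a strict contraction on N, that is (i) => (ii).

    Conversely, suppose that a power T^m contracts N by a factor rho < 1.
    Differences of points of the base lie in N, so T^m is a contraction of the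
    base, which is closed because the cone is and f is continuous.  Banach's theorem gives a
    fixed point of T^m in the base, which T fixes too ([markov_fixpoint]).
    With y0 this point, x - f(x) y0 lies in N and
    T^n x - f(x) y0 = T^n (x - f(x) y0), which decays geometrically in n %/ m
    ([markov_exponential]); this is (ii) => (iii).

    Finally (iii) => (i) is the triangle inequality through y0, as f(k) = 1 and
    |k| <= 1 for k in the base. *)

(** * The norm as a cost of decomposition *)

Section BaseNorm.
Context (R : realType) (X : completeNormedModType R) (E : obsb X).
Notation f := (obsb_fun E).

Lemma cone0 : cone E 0.
Proof. exact: obsb_le_refl. Qed.

Lemma coneD x y : cone E x -> cone E y -> cone E (x + y).
Proof.
move=> x0 y0; apply: (obsb_le_trans y0).
by have := obsb_leD y x0; rewrite add0r.
Qed.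

Lemma coneZ a x : 0 <= a -> cone E x -> cone E (a *: x).
Proof.
by move=> a0 x0; have := obsb_leZ a0 x0; rewrite scaler0.
Qed.

Lemma fun_cone_ge0 x : cone E x -> 0 <= f x.
Proof.
move=> x0; have [->|xN0] := eqVneq x 0; first by rewrite linear0.
exact/ltW/obsb_fun_gt0.
Qed.

Lemma fun_cone_eq0 x : cone E x -> f x = 0 -> x = 0.
Proof.
move=> x0 fx; apply/eqP/negPn/negP => xN0.
by have := obsb_fun_gt0 x0 xN0; rewrite fx ltxx.
Qed.

Lemma cone_base x : cone E x -> x != 0 ->
  exists2 k, base E k & x = f x *: k.
Proof.
move=> x0 xN0; have fx0 := obsb_fun_gt0 x0 xN0.
exists ((f x)^-1 *: x); last by rewrite scalerA divff ?scale1r// gt_eqF.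
split; first by apply: coneZ => //; rewrite invr_ge0 ltW.
by rewrite linearZ /= mulVf// gt_eqF.
Qed.

Lemma base_nonempty : base E !=set0.
Proof.
have [x xN0] := obsb_neq0 E; have [y [z [y0 z0 xE]]] := obsb_generating E x.
have [yE|/(cone_base y0)[k bk _]] := eqVneq y 0; last by exists k.
have [zE|/(cone_base z0)[k bk _]] := eqVneq z 0; last by exists k.
by move: xN0; rewrite xE yE zE subrr eqxx.
Qed.

(** Minimality of the hull, with the convex combinations spelled out so that it
    applies to plain sets of X and real weights. *)
Lemma unit_hull_sub (A : set X) :
  (forall x y t, A x -> A y -> 0 <= t -> t <= 1 -> A (t *: x + (1 - t) *: y)) ->
  (forall k, base E k -> A k /\ A (- k)) ->
  unit_hull (obsb_le E) f `<=` A.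
Proof.
move=> cA bA; apply: smallest_sub.
  move=> x y t; rewrite !inE => Ax Ay.
  exact: cA.
by move=> x [/bA[]//|[k /bA[_ ?] <-]].
Qed.

(** A positive x is f x times a point of the base, hence |x| <= f x, and the
    triangle inequality does the rest. *)
Lemma normB_cone_le y z : cone E y -> cone E z -> `|y - z| <= f y + f z.
Proof.
have norm_cone x : cone E x -> `|x| <= f x.
  move=> x0; have [->|xN0] := eqVneq x 0; first by rewrite normr0 linear0.
  have [k bk xE] := cone_base x0 xN0.
  rewrite (obsb_normE E); apply: ge_inf; first by exists 0 => l [].
  split; first exact: fun_cone_ge0.
  by exists k => //; apply: sub_smallest bk => ? ?; left.
by move=> y0 z0; apply: le_trans (ler_normB _ _) _; rewrite lerD ?norm_cone.
Qed.

(** Differences y - z of total mass f y + f z <= 1 form a convex set that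
    contains the base and its opposite, hence the unit hull; it remains to scale
    by some l' < l with x in l' times the hull. *)
Lemma cone_decomposition x l : `|x| < l ->
  exists y z, [/\ cone E y, cone E z, x = y - z & f y + f z <= l].
Proof.
move=> xl; have l0 : 0 <= l by apply: ltW; apply: le_lt_trans xl.
have [->|xN0] := eqVneq x 0.
  by exists 0, 0; rewrite subrr !linear0 addr0; split => //; exact: cone0.
have subV : unit_hull (obsb_le E) f `<=` [set x | exists y z,
    [/\ cone E y, cone E z, x = y - z & f y + f z <= 1]].
  apply: unit_hull_sub.
    move=> _ _ t [y [z [y0 z0 -> yz]]] [u [v [u0 v0 -> uv]]] t0 t1.
    have s0 : 0 <= 1 - t by rewrite subr_ge0.
    exists (t *: y + (1 - t) *: u), (t *: z + (1 - t) *: v).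
    split; [by apply: coneD; exact: coneZ|by apply: coneD; exact: coneZ| |].
      by rewrite !scalerBr addrACA -opprD.
    rewrite !linearD !linearZ /=.
    have := ler_wpM2l t0 yz; have := ler_wpM2l s0 uv; lra.
  move=> k [k0 fk]; split; [exists k, 0|exists 0, k];
    rewrite (linear0 f) ?subr0 ?sub0r ?fk ?addr0 ?add0r;
    by split => //; exact: cone0.
move: xl; rewrite (obsb_normE E) => /inf_lt.
case=> [|l' [l'0 [u /subV[y [z [y0 z0 -> yz]]] ->]] l'l].
  (* The infimum of the empty set is 0, whereas |x| != 0. *)
  apply/set0P/eqP => S0; move: xN0.
  by rewrite -normr_eq0 (obsb_normE E) /gauge_norm S0 inf0 eqxx.
exists (l' *: y), (l' *: z); split; [exact: coneZ|exact: coneZ| |].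
  by rewrite scalerBr.
rewrite !linearZ /= -mulrDr; apply: le_trans (ltW l'l).
by rewrite ler_piMr.
Qed.

Lemma norm_fun_le x : `|f x| <= `|x|.
Proof.
apply/unstable.ler_gtP => l /cone_decomposition[y [z [y0 z0 -> yz]]].
rewrite linearB /=; apply: le_trans (ler_normB _ _) _.
by rewrite !ger0_norm ?fun_cone_ge0.
Qed.

Lemma fun_continuous : continuous f.
Proof.
apply/linear_bounded_continuous/linear_boundedP.
near=> r => x; apply: le_trans (norm_fun_le x) _.
by apply: ler_peMl => //; near: r; apply: nbhs_pinfty_ge; rewrite num_real.
Unshelve. all: by end_near. Qed.

Lemma closed_base : closed (base E).
Proof.
apply: closedI; first exact: (@obsb_cone_closed _ _ E).
apply: (preimage_closed (D := [set 1 : R])).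
  by move=> x _; exact: fun_continuous.
exact: closed_eq.
Qed.

Lemma norm_base_le1 k : base E k -> `|k| <= 1.
Proof.
case=> k0 fk; have := normB_cone_le k0 cone0.
by rewrite subr0 linear0 addr0 fk.
Qed.

End BaseNorm.

(** * Markov operators *)

Section Markov.
Context (R : realType) (X : completeNormedModType R) (E : obsb X).
Notation f := (obsb_fun E).
Implicit Types T : X -> X.

Lemma markov0 T : markov_op E T -> T 0 = 0.
Proof.
case=> linT _ _; have := linT (-1) 0 0.
by rewrite scaler0 addr0 scaleN1r addNr.
Qed.

Lemma markovZ T a x : markov_op E T -> T (a *: x) = a *: T x.
Proof.
move=> mT; have [linT _ _] := mT.
by have := linT a x 0; rewrite (markov0 mT) !addr0.
Qed.

Lemma markovB T x y : markov_op E T -> T (x - y) = T x - T y.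
Proof.
case=> linT _ _; have := linT (-1) y x.
by rewrite !scaleN1r ![- _ + _]addrC.
Qed.

Lemma markov_base T k : markov_op E T -> base E k -> base E (T k).
Proof. by case=> _ _ bT bk; apply: bT; exists k. Qed.

Lemma markov_fun T x : markov_op E T -> f (T x) = f x.
Proof.
move=> mT; have fT y : cone E y -> f (T y) = f y.
  move=> y0; have [->|yN0] := eqVneq y 0; first by rewrite (markov0 mT).
  have [k bk ->] := cone_base y0 yN0.
  have [_ fTk] := markov_base mT bk; case: bk => _ fk.
  by rewrite markovZ// !linearZ /= fTk fk.
have [y [z [y0 z0 ->]]] := obsb_generating E x.
by rewrite markovB// !linearB /= !fT.
Qed.

(** T maps a decomposition of x to a decomposition of T x of the same mass. *)
Lemma markov_nonexpansive T x : markov_op E T -> `|T x| <= `|x|.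
Proof.
move=> mT; apply/unstable.ler_gtP => l /(cone_decomposition E).
move=> [y [z [y0 z0 -> yz]]]; have [_ pT _] := mT.
rewrite markovB//; apply: le_trans (normB_cone_le (pT _ y0) (pT _ z0)) _.
by rewrite !(markov_fun _ mT).
Qed.

(** The two parts of a decomposition of x in N have equal mass s, where 2 s can
    be chosen arbitrarily close to |x|; writing them as s k and s h gives
    T x = s (T k - T h). *)
Lemma markov_null_le T c : markov_op E T ->
  (forall x y, base E x -> base E y -> `|T x - T y| <= c) ->
  forall x, null_space E x -> `|T x| <= c / 2 * `|x|.
Proof.
move=> mT oscT x fx.
have c0 : 0 <= c.
  by have [k bk] := base_nonempty E; apply: le_trans (oscT k k bk bk).
have bound l : `|x| < l -> `|T x| <= c / 2 * l.
  move=> /(cone_decomposition E)[y [z [y0 z0 xE yz]]].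
  have fyz : f y = f z.
    by move: fx; rewrite /null_space /= xE linearB /= => /subr0_eq.
  have [y_0|yN0] := eqVneq y 0.
    have z_0 : z = 0 by apply: fun_cone_eq0 z0 _; rewrite -fyz y_0 linear0.
    rewrite xE y_0 z_0 markovB// subrr normr0.
    rewrite mulr_ge0 ?divr_ge0//.
    by apply: le_trans yz; rewrite addr_ge0// fun_cone_ge0.
  have zN0 : z != 0.
    by apply: contra yN0 => /eqP z_0; apply/eqP/(fun_cone_eq0 y0);
      rewrite fyz z_0 linear0.
  have [k bk yE] := cone_base y0 yN0; have [h bh zE] := cone_base z0 zN0.
  rewrite xE yE zE fyz -scalerBr markovZ// markovB// normrZ.
  have fz0 := fun_cone_ge0 z0; rewrite ger0_norm//.
  apply: le_trans (ler_wpM2l fz0 (oscT _ _ bk bh)) _.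
  rewrite mulrC mulrAC -mulrA ler_wpM2l//.
  by move: yz; rewrite fyz; lra.
have [c_0|cN0] := eqVneq c 0.
  by have := bound (`|x| + 1); rewrite c_0 !mul0r ltrDl; exact.
have cgt0 : 0 < c / 2 by rewrite divr_gt0// lt_neqAle eq_sym cN0.
rewrite -ler_pdivrMl//; apply/unstable.ler_gtP => l /bound.
by rewrite ler_pdivrMl.
Qed.

(** Multiplying out the norm makes the bound meaningful at 0, so that N = 0
    needs no case distinction afterwards. *)
Lemma dobrushin_leP T rho : markov_op E T -> 0 <= rho ->
  (dobrushin E T <= rho%:E)%E <->
  forall x, null_space E x -> `|T x| <= rho * `|x|.
Proof.
move=> mT rho0; rewrite /dobrushin ge_max lee_fin rho0 /=; split=> [le x Nx|le].
  have [->|xN0] := eqVneq x 0.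
    by rewrite (markov0 mT) normr0 mulr0.
  rewrite -ler_pdivrMr ?normr_gt0// -lee_fin; apply: le_trans le.
  by apply: ereal_sup_ubound; exists x.
apply: ge_ereal_sup => _ [x [Nx xN0] <-].
by rewrite lee_fin ler_pdivrMr ?normr_gt0// le.
Qed.

Lemma opnorm_le (S : X -> X) c : 0 <= c ->
  (forall x, `|S x| <= c * `|x|) -> (opnorm S <= c%:E)%E.
Proof.
move=> c0 Sc; apply: ge_ereal_sup => _ [x x1 <-]; rewrite lee_fin.
by apply: le_trans (Sc x) _; rewrite ler_piMr.
Qed.

Lemma le_opnorm (S : X -> X) x : `|x| <= 1 -> (`|S x|%:E <= opnorm S)%E.
Proof. by move=> x1; apply: ereal_sup_ubound; exists x. Qed.

Lemma opnorm_ge0 (S : X -> X) : (0 <= opnorm S)%E.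
Proof.
by apply: le_trans (le_opnorm S (x := 0) _); rewrite ?lee_fin ?normr0.
Qed.

(** * Powers of a Markov operator that contract the kernel of f *)

Section Contraction.
Context (T : X -> X) (m : nat) (rho : R).
Hypotheses (mT : markov_op E T) (rho0 : 0 <= rho) (rho1 : rho < 1).
Hypothesis contrT : forall x, null_space E x -> `|iter m T x| <= rho * `|x|.

(** Split off the remainder: T^n = T^(n %% m) (T^m)^(n %/ m), where the first
    factor is nonexpansive. *)
Lemma contraction_iter n x : null_space E x ->
  `|iter n T x| <= rho ^+ (n %/ m) * `|x|.
Proof.
move=> Nx; rewrite [in leLHS](divn_eq n m) addnC iterD.
apply: le_trans (markov_nonexpansive _ (markov_iter _ mT)) _.
elim: (n %/ m)%N => [|k IH]; first by rewrite expr0 mul1r.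
rewrite mulSn iterD exprS -mulrA.
have := contrT (x := iter (k * m) T x).
rewrite /null_space /= (markov_fun _ (markov_iter _ mT)) => /(_ Nx) le.
by apply: le_trans le _; rewrite ler_wpM2l.
Qed.

(** If y0 is a fixed point of T^m, then so is T y0; their difference lies in N
    and T^m, which fixes it, contracts it, so that it vanishes. *)
Lemma markov_fixpoint : exists2 y0, base E y0 & T y0 = y0.
Proof.
have mTm := markov_iter m mT.
have subN x y : base E x -> base E y -> null_space E (x - y).
  by move=> [_ fx] [_ fy]; rewrite /null_space /= linearB /= fx fy subrr.
pose S0 := iter m T.
have funS0 : set_fun (base E) (base E) S0 by move=> k; exact: markov_base.
pose FS := isFun.Build _ _ (base E) (base E) S0 funS0.
pose S : {fun base E >-> base E} := HB.pack S0 FS.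
have ctrS : is_contraction S.
  exists (NngNum rho0); split => //= -[x y] [/= bx by_].
  by rewrite -markovB//; apply: contrT; exact: subN.
have [y0 by0 /= Sy0] :=
  banach_fixed_point ctrS (@closed_base _ _ E) (base_nonempty E).
exists y0 => //.
have NT : null_space E (T y0 - y0) by apply: subN => //; exact: markov_base.
have := contrT NT; rewrite (markovB _ _ mTm) -iterSr iterS -[iter m T y0]Sy0.
move=> le; have rho1_gt0 : 0 < 1 - rho by rewrite subr_gt0.
apply/eqP; rewrite -subr_eq0 -normr_le0 -(pmulr_rle0 _ rho1_gt0).
by rewrite mulrBl mul1r subr_le0.
Qed.

(** T^n - T_y0 is T^n applied to the projection x - f(x) y0 of x on N, whose
    norm is at most 2 |x|.  Replacing n %/ m by n / m - 1 in the exponent turns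
    the geometric decay into an exponential one. *)
Lemma markov_exponential : (0 < m)%N -> exists (C alpha : R) (y0 : X),
  [/\ 0 < C, 0 < alpha, base E y0 &
    forall n, (opnorm (fun x => (iter n T x - rank1_op E y0 x)%R)
                 <= (C * expR (- alpha * n%:R))%R%:E)%E].
Proof.
move=> m0; have [y0 by0 Ty0] := markov_fixpoint.
(* The rate must be positive to have a logarithm, hence the maximum. *)
pose r := Num.max rho 2^-1.
have r0 : 0 < r by rewrite lt_max invr_gt0 ltr0n orbT.
have r1 : r < 1 by rewrite gt_max rho1 /=; lra.
have mR : 0 < m%:R :> R by rewrite ltr0n.
pose alpha := - ln r / m%:R.
have a0 : 0 < alpha by rewrite divr_gt0// oppr_gt0 ln_lt0// r0.
have rE : r = expR (- alpha * m%:R).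
  by rewrite mulNr divfK ?gt_eqF// opprK lnK.
have iter_y0 n : iter n T y0 = y0 by elim: n => //= n ->.
(* The factor 1 / r pays for rounding n / m down to n %/ m. *)
exists (2 / r), alpha, y0; split => // [|n]; first by rewrite divr_gt0.
apply: opnorm_le => [|x]; first by rewrite mulr_ge0 ?expR_ge0 ?divr_ge0 ?ltW.
have -> : iter n T x - rank1_op E y0 x = iter n T (x - f x *: y0).
  have mTn := markov_iter n mT.
  by rewrite (markovB _ _ mTn) (markovZ _ _ mTn) iter_y0.
have Nx : null_space E (x - f x *: y0).
  case: by0 => _ fy0.
  by rewrite /null_space /= linearB linearZ /= fy0 mulr1 subrr.
have norm2 : `|x - f x *: y0| <= 2 * `|x|.
  apply: le_trans (ler_normB _ _) _; rewrite mulrDl mul1r lerD2l normrZ.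
  rewrite -[leRHS]mulr1 ler_pM ?norm_fun_le//; exact: norm_base_le1 by0.
have rho_r : rho ^+ (n %/ m) <= r ^+ (n %/ m).
  by rewrite lerXn2r ?nnegrE ?(ltW r0)// le_max lexx.
apply: le_trans (contraction_iter n Nx) _.
apply: le_trans (ler_pM _ _ rho_r norm2) _; rewrite ?exprn_ge0//.
rewrite mulrA ler_wpM2r// mulrC -mulrA ler_wpM2l// ler_pdivlMl//.
rewrite -exprS rE -expRM_natl ler_expR.
rewrite mulrCA !mulNr lerN2 ler_wpM2l ?(ltW a0)//.
by rewrite -natrM ler_nat ltnW// ltn_ceil.
Qed.

End Contraction.
End Markov.

(** * Equivalence of the ergodicity conditions *)

Theorem theorem3p5 (R : realType) (X : completeNormedModType R) (E : obsb X)
    (T : X -> X) (markovT : markov_op E T) :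
  [<-> weakly_ergodic (homogeneous_chain markovT) ;
       exists (rho : R) (n0 : nat),
         [/\ 0 <= rho, rho < 1 & (dobrushin E (iter n0 T) <= rho%:E)%E] ;
       uniformly_ergodic (homogeneous_chain markovT) /\
       exists (C alpha : R) (n0 : nat) (y0 : X),
         [/\ 0 < C, 0 < alpha, base E y0 &
           forall n : nat, (n0 <= n)%N ->
             (opnorm (fun x => iter n T x - rank1_op E y0 x)%R
                <= (C * expR (- alpha * n%:R))%R%:E)%E] ].
Proof.
tfae.
- move=> /(_ 0%N) /= wT.
  have [n _ /(_ n (leqnn n)) /=] := wT _ (open_ereal_lt' lte01).
  rewrite subn0 => /ltW supn.
  have mTn := markov_iter n markovT.
  (* An oscillation of 1 over the base is halved by [markov_null_le]. *)
  exists (1 / 2), n; split; [lra|lra|].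
  apply/dobrushin_leP => //; apply: markov_null_le => // x y bx by_.
  rewrite -lee_fin; apply: le_trans supn.
  by apply: ereal_sup_ubound; exists (x, y).
- move=> [rho [n0 [rho0 rho1]]].
  move=> /dobrushin_leP-/(_ (markov_iter n0 markovT) rho0) dT.
  (* n0 may be 0 when N is trivial; one more step makes the period positive. *)
  have contrT x : null_space E x -> `|iter n0.+1 T x| <= rho * `|x|.
    move=> Nx; apply: le_trans (dT _ Nx).
    exact: (markov_nonexpansive _ markovT).
  have [C [alpha [y0 [C0 a0 by0 le]]]] :=
    markov_exponential markovT rho0 rho1 contrT (ltn0Sn n0).
  split; last by exists C, alpha, 0%N, y0; split => // n _; exact: le.
  exists y0 => k /=.
  have expcvg :
      (fun n => (C * expR (- alpha * n%:R))%:E) @ \oo --> (0%E : \bar R).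
    have z1 : `|expR (- alpha)| < 1.
      by rewrite ger0_norm ?expR_ge0// -expR0 ltr_expR oppr_lt0.
    apply/fine_cvgP; split; first exact: nearW.
    apply: cvg_trans (cvg_geometric C z1); apply: near_eq_cvg.
    apply: nearW => n /=.
    by rewrite [-alpha * _]mulrC expRM_natl.
  apply: squeeze_cvge (cvg_cst 0%E) (cvg_comp _ _ (@cvg_subnr k) expcvg).
  by apply: nearW => n; rewrite opnorm_ge0 /= le.
- move=> [[y0 uT] _] k /=.
  have twice_cvg : (fun n => 2%:E *
      opnorm (fun x => iter (n - k) T x - rank1_op E y0 x)%R)%E
        @ \oo --> (0%E : \bar R).
    by rewrite -[X in _ --> X](mule0 2%:E); apply: cvgeZl => //; exact: uT.
  apply: squeeze_cvge (cvg_cst 0%E) twice_cvg.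
  apply: nearW => n; apply/andP; split.
    have [b bb] := base_nonempty E.
    apply: le_trans (ereal_sup_ubound _); last by exists (b, b).
    by rewrite lee_fin.
  apply: ge_ereal_sup => _ [[x y] [/= bx by_] <-].
  have unif z : base E z -> (`|iter (n - k) T z - y0|%:E <=
      opnorm (fun x => iter (n - k) T x - rank1_op E y0 x)%R)%E.
    move=> bz; have := le_opnorm
      (fun x => iter (n - k) T x - rank1_op E y0 x)%R (norm_base_le1 bz).
    by case: bz => _ fz; rewrite /rank1_op fz scale1r.
  rewrite (_ : 2%:E = 1%:E + 1%:E)%E ?ge0_muleDl// !mul1e.
  apply: le_trans (leeD (unif _ bx) (unif _ by_)).
  by rewrite -EFinD lee_fin [X in _ <= _ + X]distrC ler_distD.
Qed.
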